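(* The space $\mathbb{P}_3$ of bivariate polynomials of total degree at most $3$ (regarded as functions on $\Omega$) is a subspace of $\mathbb{S}_3^{\mathrm R}(\Delta_{\mathrm{PS}})$.
   Context: Triangulation. $\Omega\subset\mathbb{R}^2$ is a polygonal domain and $\Delta=(V,E,T)$ is a triangulation of it: $V=\{v_i\}$ is a finite set of vertices (points), $E=\{e_{ij}\}$ a finite set of edges $e_{ij}=[v_i,v_j]$ and $T=\{t_{ijk}\}$ a finite set of nondegenerate triangles $t_{ijk}=[v_i,v_j,v_k]$, where $[\cdot]$ denotes the convex hull. The union of the triangles is $\Omega$, two different triangles intersect in the empty set, an element of $V$ or an element of $E$, and every vertex and edge belongs to at least one triangle. $E^b\subseteq E$ is the set of edges on the boundary of $\Omega$; an edge of $E\setminus E^b$ is shared by two triangles, an edge of $E^b$ belongs to one. Index convention: indices not separated by a comma may be permuted ($a_{ij}=a_{ji}$, $a_{ij,k}=a_{ji,k}$), while the order of comma-separated indices matters. Powell--Sabin refinement. $\Delta_{\mathrm{PS}}=(V_{\mathrm{PS}},E_{\mathrm{PS}},T_{\mathrm{PS}})$ is obtained as follows. A split point $v_{ijk}$ is chosen inside each $t_{ijk}\in T$ so that for every interior edge $e_{ij}$ shared by $t_{ijk},t_{ijk'}\in T$ the segment $[v_{ijk},v_{ijk'}]$ intersects $e_{ij}$ in a point $v_{ij}$ inside $e_{ij}$; for $e_{ij}\in E^b$, $v_{ij}$ is an arbitrary point inside $e_{ij}$. Each $t_{ijk}$ is split into six triangles: $t_{i,j,k}=[v_i,v_{ij},v_{ijk}]$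 and the triangles $t_{j,i,k},t_{j,k,i},t_{k,j,i},t_{k,i,j},t_{i,k,j}$ defined by the same rule ($t_{a,b,c}=[v_a,v_{ab},v_{abc}]$). These form $T_{\mathrm{PS}}$. Also $e_{i,j}=[v_i,v_{ij}]$, and $E^b_{\mathrm{PS}}$ is the set of all such half-edges $e_{i,j},e_{j,i}$ with $e_{ij}\in E^b$. Blossom. For $P\in\mathbb{P}_3$, the blossom $\mathcal{B}[P]:(\mathbb{R}^2)^3\to\mathbb{R}$ is the unique symmetric map that is affine in each argument and satisfies $\mathcal{B}[P](p,p,p)=P(p)$. For a spline $S$, $\mathcal{B}[S|_{t}]$ is the blossom of the polynomial coinciding with $S$ on $t$; for a half-edge $e_{i,j}\in E^b_{\mathrm{PS}}$, $\mathcal{B}[S|_{e_{i,j}}](v_i,v_j,v_{ij})$ is the blossom of the polynomial piece on the triangle of $T_{\mathrm{PS}}$ containing $e_{i,j}$. Spline space and its basis. $\mathbb{S}_3^1(\Delta_{\mathrm{PS}})=\{S\in C^1(\Omega): S|_{t}\in\mathbb{P}_3 \text{ for all } t\in T_{\mathrm{PS}}\}$. For each $v_i\in V$ fix a triangle $[q^v_{i,1},q^v_{i,2},q^v_{i,3}]$ containing $v_i$, all points $\frac23v_i+\frac13v_{ijk}$ ($t_{ijk}\in T$ with vertex $v_i$) and all points $\frac23v_i+\frac13v_{ij}$ ($e_{ij}\in E$ with endpoint $v_i$). Define the functionals $\beta^v_{i,r}(S)=\mathcal{B}[S|_{t_{i,j,k}}](v_i,v_i,v_i+3(q^v_{i,r}-v_i))$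 for $v_i\in V$, $r=1,2,3$ (with any $t_{i,j,k}\in T_{\mathrm{PS}}$ having a vertex at $v_i$; independent of the choice); $\beta^t_{i,j,k}(S)=\mathcal{B}[S|_{t_{i,j,k}}](v_i,v_j,v_{ijk})$ for $t_{i,j,k}\in T_{\mathrm{PS}}$; $\beta^e_{i,j}(S)=\mathcal{B}[S|_{e_{i,j}}](v_i,v_j,v_{ij})$ for $e_{i,j}\in E^b_{\mathrm{PS}}$. It is known that these functionals form a basis of the dual space of $\mathbb{S}_3^1(\Delta_{\mathrm{PS}})$; let $B^v_{i,r}$, $B^t_{i,j,k}$, $B^e_{i,j}$ be the corresponding dual basis of $\mathbb{S}_3^1(\Delta_{\mathrm{PS}})$ (each function has value 1 under its own functional and 0 under all the others). Symmetric triangles. $T_{\mathrm S}\subseteq T$ is the set of symmetrically refined triangles $t_{ijk}$, i.e. those for which each of the triples $(v_k,v_{ijk},v_{ij})$, $(v_j,v_{ijk},v_{ki})$, $(v_i,v_{ijk},v_{jk})$ is collinear. Combined functions. For $e_{ij}\in E$ and a triangle $t_{ijk}$ attached to $e_{ij}$ put $w_{ij,k}=v_k$ if $t_{ijk}\in T_{\mathrm S}$ and $w_{ij,k}=v_{ijk}$ otherwise. If $e_{ij}\in E\setminus E^b$ is shared by $t_{ijk},t_{ijk'}$, let $\omega_{ij,k},\omega_{ij,k'}\in[0,1]$ satisfy $v_{ijk}=(1-\omega_{ij,k})w_{ij,k}+\omega_{ij,k}w_{ij,k'}$ and $v_{ijk'}=(1-\omega_{ij,k'})w_{ij,k'}+\omega_{ij,k'}w_{ij,k}$,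 and set $B^e_{ij,k}=(1-\omega_{ij,k})(B^t_{i,j,k}+B^t_{j,i,k})+\omega_{ij,k'}(B^t_{i,j,k'}+B^t_{j,i,k'})$ (and $B^e_{ij,k'}$ by exchanging $k$ and $k'$). If $e_{ij}\in E^b$ belongs to $t_{ijk}$, let $\omega_{ij,k}\in[0,1]$ satisfy $v_{ijk}=(1-\omega_{ij,k})w_{ij,k}+\omega_{ij,k}v_{ij}$, and set $B^e_{ij,k}=(1-\omega_{ij,k})(B^t_{i,j,k}+B^t_{j,i,k})$ and $B^e_{ij}=(B^e_{i,j}+B^e_{j,i})+\omega_{ij,k}(B^t_{i,j,k}+B^t_{j,i,k})$. For $t_{ijk}\in T_{\mathrm S}$ set $B^t_{ijk}=B^e_{ij,k}+B^e_{jk,i}+B^e_{ki,j}$. Reduced space. Let $T^e_{ij}\subseteq T$ be the set of triangles attached to $e_{ij}$. The set $\mathcal{S}_{\mathrm R}$ consists of: $B^v_{i,r}$ for $v_i\in V$, $r\in\{1,2,3\}$; $B^t_{ijk}$ for $t_{ijk}\in T_{\mathrm S}$; $B^e_{ij,k}$ for $e_{ij}\in E$ and $t_{ijk}\in T^e_{ij}\setminus T_{\mathrm S}$; $B^e_{ij}$ for $e_{ij}\in E^b$. $\mathbb{S}_3^{\mathrm R}(\Delta_{\mathrm{PS}})$ is the vector space spanned by $\mathcal{S}_{\mathrm R}$. *)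

(* Defs.v *)
From HB Require Import structures.
From mathcomp Require Import all_boot all_order all_algebra.
From mathcomp Require Import all_classical all_reals all_analysis.

Set Implicit Arguments.
Unset Strict Implicit.
Unset Printing Implicit Defensive.

Import Order.TTheory GRing.Theory Num.Theory.
Import numFieldNormedType.Exports.

Local Open Scope classical_set_scope.
Local Open Scope ring_scope.

(* The plane is 'rV[R]_2.  A real function on a domain Omega is a function
   f : 'rV[R]_2 -> R of which only the values on Omega matter: all notions below
   that concern functions on Omega are invariant under changes outside Omega. *)

Definition hull (R : realType) (s : seq 'rV[R]_2) : set 'rV[R]_2 :=
  [set x | exists a : 'I_(size s) -> R,
     [/\ forall l, 0 <= a l, \sum_l a l = 1 & x = \sum_l a l *: s`_l]].

(* For affinely independent points: the relative interior of hull s. *)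
Definition inside (R : realType) (s : seq 'rV[R]_2) : set 'rV[R]_2 :=
  [set x | exists a : 'I_(size s) -> R,
     [/\ forall l, 0 < a l, \sum_l a l = 1 & x = \sum_l a l *: s`_l]].

Definition collinear (R : realType) (a b c : 'rV[R]_2) : Prop :=
  exists p d : 'rV[R]_2, forall x, x \in [:: a; b; c] ->
    exists s : R, x = p + s *: d.

Definition boundary_of (R : realType) (D : set 'rV[R]_2) : set 'rV[R]_2 :=
  closure D `\` interior D.

Definition face (R : realType) (I : finType) (v : I -> 'rV[R]_2)
    (A : {set I}) : set 'rV[R]_2 :=
  hull [seq v i | i in A].

Definition boundary_edges (R : realType) (I : finType) (Omega : set 'rV[R]_2)
    (v : I -> 'rV[R]_2) (E : {set {set I}}) : {set {set I}} :=
  [set e in E | `[< face v e `<=` boundary_of Omega >]]%SET.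

Definition attached (I : finType) (T : {set {set I}}) (e : {set I}) :
    {set {set I}} :=
  [set t in T | e \subset t]%SET.

(* Vertices are indexed by vidx.  Edges and triangles are the sets of the
   indices of their vertices, so that a quantity attached to e_ij or t_ijk is
   a function of [set i; j] or [set i; j; k] and is thereby invariant under
   the permutation of indices that are not separated by a comma. *)
Record triangulation (R : realType) (Omega : set 'rV[R]_2) := Triangulation {
  vidx : finType;
  vtx : vidx -> 'rV[R]_2;
  edges : {set {set vidx}};
  tris : {set {set vidx}};
  vtx_inj : injective vtx;
  tris_card : forall t, t \in tris -> #|t| = 3%N;
  tris_nondegenerate : forall i j k, [set i; j; k]%SET \in tris ->
    ~ collinear (vtx i) (vtx j) (vtx k);
  (* every edge belongs to a triangle, and every side of a triangle is an edge *)
  edgesP : forall e, e \in edges <->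
    #|e| = 2%N /\ exists2 t, t \in tris & e \subset t;
  vtx_in_tri : forall i, exists2 t, t \in tris & i \in t;
  tris_cover : Omega = \bigcup_(t in [set` tris]) face vtx t;
  tris_meet : forall t t', t \in tris -> t' \in tris -> t != t' ->
    [\/ face vtx t `&` face vtx t' = set0,
        exists i, face vtx t `&` face vtx t' = [set vtx i]
      | exists2 e, e \in edges & face vtx t `&` face vtx t' = face vtx e];
  interior_edge : forall e, e \in edges :\: boundary_edges Omega vtx edges ->
    #|attached tris e| = 2%N;
  boundary_edge : forall e, e \in boundary_edges Omega vtx edges ->
    #|attached tris e| = 1%N
}.

Definition bedges (R : realType) (Omega : set 'rV[R]_2)
    (D : triangulation Omega) : {set {set vidx D}} :=
  boundary_edges Omega (@vtx R Omega D) (edges D).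

Record powell_sabin (R : realType) (Omega : set 'rV[R]_2)
    (D : triangulation Omega) := PowellSabin {
  tsplit : {set vidx D} -> 'rV[R]_2;
  esplit : {set vidx D} -> 'rV[R]_2;
  tsplit_inside : forall t, t \in tris D ->
    inside [seq vtx i | i in t] (tsplit t);
  esplit_inside : forall e, e \in edges D ->
    inside [seq vtx i | i in e] (esplit e);
  esplit_interior : forall e t t', e \in edges D :\: bedges D ->
    t \in attached (tris D) e -> t' \in attached (tris D) e -> t != t' ->
    hull [:: tsplit t; tsplit t'] `&` face (@vtx R Omega D) e = [set esplit e]
}.

(* The triangle t_{i,j,k}; these are the triangles of the refinement when
   [set i; j; k] ranges over the triangles of D. *)
Definition ps_tri (R : realType) (Omega : set 'rV[R]_2)
    (D : triangulation Omega) (PS : powell_sabin D) (i j k : vidx D) :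
    set 'rV[R]_2 :=
  hull [:: vtx i; esplit PS [set i; j]%SET; tsplit PS [set i; j; k]%SET].

(* Bivariate polynomials of total degree at most 3, as functions. *)
Definition cubic (R : realType) : set ('rV[R]_2 -> R) :=
  [set P | exists c : 'I_4 -> 'I_4 -> R, forall x : 'rV[R]_2,
     P x = \sum_(a < 4) \sum_(b < 4 | (a + b <= 3)%N)
             c a b * x 0 0 ^+ a * x 0 1 ^+ b].

Definition affine_fun (R : realType) (f : 'rV[R]_2 -> R) : Prop :=
  forall (s : R) (x y : 'rV[R]_2),
    f ((1 - s) *: x + s *: y) = (1 - s) * f x + s * f y.

Definition is_blossom (R : realType) (P : 'rV[R]_2 -> R) :
    set ('rV[R]_2 -> 'rV[R]_2 -> 'rV[R]_2 -> R) :=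
  [set F | [/\ forall x y z, F x y z = F y x z,
               forall x y z, F x y z = F x z y,
               forall y z, affine_fun (fun x => F x y z)
             & forall p, F p p p = P p]].

(* The default value is never reached for cubic P. *)
Definition blossom (R : realType) (P : 'rV[R]_2 -> R) :
    'rV[R]_2 -> 'rV[R]_2 -> 'rV[R]_2 -> R :=
  xget (fun _ _ _ => 0) (is_blossom P).

(* The cubic polynomial coinciding with S on t. *)
Definition piece (R : realType) (S : 'rV[R]_2 -> R) (t : set 'rV[R]_2) :
    'rV[R]_2 -> R :=
  xget (fun=> 0) [set P | cubic P /\ forall x, t x -> S x = P x].

(* Continuous differentiability relative to a domain that contains its
   boundary: g is the gradient of f. *)
Definition C1_on (R : realType) (D : set 'rV[R]_2) (f : 'rV[R]_2 -> R) : Prop :=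
  exists g : 'rV[R]_2 -> 'rV[R]_2, {within D, continuous g} /\
    forall x, D x -> forall eps : R, 0 < eps ->
      \forall y \near within D (nbhs x),
        `|f y - f x - (g x *m (y - x)^T) 0 0| <= eps * `|y - x|.

Definition spline_space (R : realType) (Omega : set 'rV[R]_2)
    (D : triangulation Omega) (PS : powell_sabin D) : set ('rV[R]_2 -> R) :=
  [set S | C1_on Omega S /\
     forall i j k, [set i; j; k]%SET \in tris D ->
       exists2 P, cubic P & forall x, ps_tri PS i j k x -> S x = P x].

(* The linear span of G, as functions on Omega. *)
Definition span_on (R : realType) (Omega : set 'rV[R]_2)
    (G : set ('rV[R]_2 -> R)) : set ('rV[R]_2 -> R) :=
  [set f | exists n (c : 'I_n -> R) (g : 'I_n -> 'rV[R]_2 -> R),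
     (forall l, G (g l)) /\
     forall x, Omega x -> f x = \sum_(l < n) c l * g l x].

Definition is_vertex_triangles (R : realType) (Omega : set 'rV[R]_2)
    (D : triangulation Omega) (PS : powell_sabin D)
    (q : vidx D -> 'I_3 -> 'rV[R]_2) : Prop :=
  forall i,
    let tq := hull [seq q i r | r : 'I_3] in
    [/\ ~ collinear (q i 0) (q i 1) (q i 2%:R),
        tq (vtx i),
        forall t, t \in tris D -> i \in t ->
          tq ((2 / 3) *: vtx i + (1 / 3) *: tsplit PS t)
      & forall e, e \in edges D -> i \in e ->
          tq ((2 / 3) *: vtx i + (1 / 3) *: esplit PS e)].

(* Indices of the functionals beta^v_{i,r}, beta^t_{i,j,k}, beta^e_{i,j}. *)
Inductive fidx (I : Type) :=
  | Fv of I & 'I_3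
  | Ft of I & I & I
  | Fe of I & I.

Definition valid_fidx (R : realType) (Omega : set 'rV[R]_2)
    (D : triangulation Omega) (a : fidx (vidx D)) : bool :=
  match a with
  | Fv i r => true
  | Ft i j k => [set i; j; k]%SET \in tris D
  | Fe i j => [set i; j]%SET \in bedges D
  end.

(* For a boundary edge e_ij: the index k of the only triangle t_ijk. *)
Definition opposite (R : realType) (Omega : set 'rV[R]_2)
    (D : triangulation Omega) (i j : vidx D) : vidx D :=
  odflt i [pick k | [set i; j; k]%SET \in tris D].

(* nb i = (j, k) designates the triangle t_{i,j,k} used to define beta^v_{i,r}. *)
Definition beta (R : realType) (Omega : set 'rV[R]_2)
    (D : triangulation Omega) (PS : powell_sabin D)
    (q : vidx D -> 'I_3 -> 'rV[R]_2) (nb : vidx D -> vidx D * vidx D)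
    (a : fidx (vidx D)) (S : 'rV[R]_2 -> R) : R :=
  match a with
  | Fv i r =>
      blossom (piece S (ps_tri PS i (nb i).1 (nb i).2))
        (vtx i) (vtx i) (vtx i + 3 *: (q i r - vtx i))
  | Ft i j k =>
      blossom (piece S (ps_tri PS i j k))
        (vtx i) (vtx j) (tsplit PS [set i; j; k]%SET)
  | Fe i j =>
      blossom (piece S (ps_tri PS i j (opposite i j)))
        (vtx i) (vtx j) (esplit PS [set i; j]%SET)
  end.

(* B is the basis of the spline space dual to the functionals beta; linear
   independence is implied by duality. *)
Definition is_dual_basis (R : realType) (Omega : set 'rV[R]_2)
    (D : triangulation Omega) (PS : powell_sabin D)
    (q : vidx D -> 'I_3 -> 'rV[R]_2) (nb : vidx D -> vidx D * vidx D)
    (B : fidx (vidx D) -> 'rV[R]_2 -> R) : Prop :=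
  [/\ forall a, valid_fidx a -> spline_space PS (B a),
      spline_space PS `<=` span_on Omega [set B a | a in @valid_fidx _ _ D],
      forall a, valid_fidx a -> beta PS q nb a (B a) = 1
    & forall a b, valid_fidx a -> valid_fidx b -> a <> b ->
        beta PS q nb a (B b) = 0].

Definition sym_tris (R : realType) (Omega : set 'rV[R]_2)
    (D : triangulation Omega) (PS : powell_sabin D) : {set {set vidx D}} :=
  [set t in tris D | `[< forall i j k, t = [set i; j; k]%SET ->
     collinear (vtx k) (tsplit PS t) (esplit PS [set i; j]%SET) >]]%SET.

Definition wpt (R : realType) (Omega : set 'rV[R]_2)
    (D : triangulation Omega) (PS : powell_sabin D) (i j k : vidx D) :
    'rV[R]_2 :=
  let t := [set i; j; k]%SET in
  if t \in sym_tris PS then vtx k else tsplit PS t.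

(* om [set i; j] k stands for omega_{ij,k}, and wpt PS i j k for w_{ij,k}. *)
Definition is_weights (R : realType) (Omega : set 'rV[R]_2)
    (D : triangulation Omega) (PS : powell_sabin D)
    (om : {set vidx D} -> vidx D -> R) : Prop :=
  [/\ forall i j k, [set i; j; k]%SET \in tris D ->
        0 <= om [set i; j]%SET k <= 1,
      forall i j k k', [set i; j]%SET \in edges D :\: bedges D ->
        [set i; j; k]%SET \in tris D -> [set i; j; k']%SET \in tris D ->
        k != k' ->
        tsplit PS [set i; j; k]%SET =
          (1 - om [set i; j]%SET k) *: wpt PS i j k
          + om [set i; j]%SET k *: wpt PS i j k'
    & forall i j k, [set i; j]%SET \in bedges D ->
        [set i; j; k]%SET \in tris D ->
        tsplit PS [set i; j; k]%SET =
          (1 - om [set i; j]%SET k) *: wpt PS i j k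
          + om [set i; j]%SET k *: esplit PS [set i; j]%SET].

(* Be_tri is B^e_{ij,k}, Be_bd is B^e_{ij} (for a boundary edge) and Bt_sym is
   B^t_{ijk}.  In Be_tri the sum over k' has exactly one term if e_ij is an
   interior edge and is empty if e_ij is a boundary edge. *)
Definition Be_tri (R : realType) (Omega : set 'rV[R]_2)
    (D : triangulation Omega) (B : fidx (vidx D) -> 'rV[R]_2 -> R)
    (om : {set vidx D} -> vidx D -> R) (i j k : vidx D) (x : 'rV[R]_2) : R :=
  (1 - om [set i; j]%SET k) * (B (Ft i j k) x + B (Ft j i k) x)
  + \sum_(k' | (k' != k) && ([set i; j; k']%SET \in tris D))
      om [set i; j]%SET k' * (B (Ft i j k') x + B (Ft j i k') x).

Definition Be_bd (R : realType) (Omega : set 'rV[R]_2)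
    (D : triangulation Omega) (B : fidx (vidx D) -> 'rV[R]_2 -> R)
    (om : {set vidx D} -> vidx D -> R) (i j : vidx D) (x : 'rV[R]_2) : R :=
  let k := opposite i j in
  (B (Fe i j) x + B (Fe j i) x)
  + om [set i; j]%SET k * (B (Ft i j k) x + B (Ft j i k) x).

Definition Bt_sym (R : realType) (Omega : set 'rV[R]_2)
    (D : triangulation Omega) (B : fidx (vidx D) -> 'rV[R]_2 -> R)
    (om : {set vidx D} -> vidx D -> R) (i j k : vidx D) (x : 'rV[R]_2) : R :=
  Be_tri B om i j k x + Be_tri B om j k i x + Be_tri B om k i j x.

Definition reduced_set (R : realType) (Omega : set 'rV[R]_2)
    (D : triangulation Omega) (PS : powell_sabin D)
    (B : fidx (vidx D) -> 'rV[R]_2 -> R)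
    (om : {set vidx D} -> vidx D -> R) : set ('rV[R]_2 -> R) :=
  [set f | [\/ exists i r, f = B (Fv i r),
     exists i j k, [set i; j; k]%SET \in sym_tris PS /\ f = Bt_sym B om i j k,
     exists i j k, [set i; j; k]%SET \in tris D :\: sym_tris PS /\
       f = Be_tri B om i j k
   | exists i j, [set i; j]%SET \in bedges D /\ f = Be_bd B om i j]].

Definition reduced_space (R : realType) (Omega : set 'rV[R]_2)
    (D : triangulation Omega) (PS : powell_sabin D)
    (B : fidx (vidx D) -> 'rV[R]_2 -> R)
    (om : {set vidx D} -> vidx D -> R) : set ('rV[R]_2 -> R) :=
  span_on Omega (reduced_set PS B om).

(* Main.v *)
(* A cubic P is a spline, so on Omega it is the combination of the dual basis
   functions with coefficients beta(P), which are values of the blossom F of P.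
   Both F(v_i, v_j, .) and the weights omega are affine data: writing the split
   point v_ijk as (1 - omega) w_ij,k + omega w_ij,k' (or v_ij in place of w_ij,k'
   on the boundary) turns the part of the expansion attached to e_ij into a
   combination of the B^e_ij,k with coefficients F(v_i, v_j, w_ij,k).  In a
   symmetric triangle w_ij,k = v_k, so the coefficients F(v_i, v_j, v_k) of its
   three edges coincide and only the sum B^t_ijk is needed. *)

Require Import Defs.
From mathcomp Require Import all_boot all_order all_algebra.
From mathcomp Require Import all_classical all_reals all_analysis.
From mathcomp Require Import ring lra.
Set Implicit Arguments.
Unset Strict Implicit.
Unset Printing Implicit Defensive.
Import Order.TTheory GRing.Theory Num.Theory.
Import numFieldNormedType.Exports.
Local Open Scope classical_set_scope.
Local Open Scope ring_scope.

(** * Cubic polynomials, affine functions and the blossom *)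

Lemma cubic_lin (R : realType) (I : Type) (r : seq I) (c : I -> R)
    (p : I -> 'rV[R]_2 -> R) :
  (forall i, cubic (p i)) -> cubic (fun x => \sum_(i <- r) c i * p i x).
Proof.
move=> /choice[d dE]; exists (fun a b => \sum_(i <- r) c i * d i a b) => x.
under eq_bigr do rewrite dE mulr_sumr.
rewrite exchange_big; apply: eq_bigr => a _ /=.
under eq_bigr do rewrite mulr_sumr.
rewrite exchange_big; apply: eq_bigr => b _ /=.
by rewrite !mulr_suml; apply: eq_bigr => i _; rewrite !mulrA.
Qed.

Lemma row2E (R : nzRingType) (x y : 'rV[R]_2) :
  x 0 0 = y 0 0 -> x 0 1 = y 0 1 -> x = y.
Proof.
move=> e0 e1; apply/rowP => -[[|[|//]] i2].
- by rewrite (_ : Ordinal i2 = 0) //; apply: val_inj.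
- by rewrite (_ : Ordinal i2 = 1) //; apply: val_inj.
Qed.

Section Affine.
Variables (R : realType) (f : 'rV[R]_2 -> R).
Hypothesis f_affine : affine_fun f.

Lemma affine_mid u v : f (2^-1 *: (u + v)) = (f u + f v) / 2.
Proof.
have -> : 2^-1 *: (u + v) = (1 - 2^-1) *: u + 2^-1 *: v.
  by apply: row2E; rewrite !mxE; field.
by rewrite f_affine; field.
Qed.

(** [affine_fun] only speaks of two points. Base point 0 gives the rule for scalar multiples, the
    midpoint gives the rule for sums, and the copies of [f 0] cancel because the coefficients sum to
    1. The coefficients may have any sign. *)
Lemma affine_comb3 a b c u v w : a + b + c = 1 ->
  f (a *: u + b *: v + c *: w) = a * f u + b * f v + c * f w.
Proof.
move=> abc.
have fZ s x : f (s *: x) = (1 - s) * f 0 + s * f x.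
  by rewrite -f_affine scaler0 add0r.
have fD x y : f (x + y) = f x + f y - f 0.
  have -> : x + y = 2 *: (2^-1 *: (x + y)) by rewrite scalerA divff ?scale1r.
  by rewrite fZ affine_mid; field.
have -> : c = 1 - a - b by rewrite -abc; ring.
by rewrite !fD !fZ; ring.
Qed.

Lemma affine_centroid u v w : f (3^-1 *: (u + v + w)) = (f u + f v + f w) / 3.
Proof.
by rewrite !scalerDr affine_comb3; field.
Qed.

End Affine.

(* The polarization identity
   6 xyz = (x+y+z)^3 - (x+y)^3 - (x+z)^3 - (y+z)^3 + x^3 + y^3 + z^3, with the
   sums scaled to affine combinations. *)
Definition polarization (R : realType) (P : 'rV[R]_2 -> R) (u v w : 'rV[R]_2) : R :=
  (27 * P (3^-1 *: (u + v + w))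
   - 8 * (P (2^-1 *: (u + v)) + P (2^-1 *: (u + w)) + P (2^-1 *: (v + w)))
   + (P u + P v + P w)) / 6.

Lemma polarization_lin (R : realType) (I : Type) (r : seq I) (c : I -> R)
    (p : I -> 'rV[R]_2 -> R) u v w :
  polarization (fun x => \sum_(i <- r) c i * p i x) u v w =
  \sum_(i <- r) c i * polarization (p i) u v w.
Proof.
rewrite /polarization; elim: r => [|i r IH]; first by rewrite !big_nil; field.
by rewrite !big_cons -IH; field.
Qed.

(** Uniqueness of the blossom: once the diagonal values are expanded by affinity and symmetry, all
    terms with a repeated argument cancel and 6 F(u, v, w) remains. The regularity of [P] does not
    enter. *)
Lemma polarization_blossom (R : realType) (P : 'rV[R]_2 -> R) F :
  is_blossom P F -> F = polarization P.
Proof.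
move=> [F12 F23 Faff FP].
apply/funext => u; apply/funext => v; apply/funext => w; rewrite /polarization.
have Fmid1 x y a b : F (2^-1 *: (x + y)) a b = (F x a b + F y a b) / 2.
  by rewrite (affine_mid (Faff a b)).
have Fmid2 x y a b : F a (2^-1 *: (x + y)) b = (F a x b + F a y b) / 2.
  by rewrite F12 Fmid1 !(F12 a).
have Fmid3 x y a b : F a b (2^-1 *: (x + y)) = (F a b x + F a b y) / 2.
  by rewrite F23 Fmid2 !(F23 a b).
have Fcen1 x y z a b :
    F (3^-1 *: (x + y + z)) a b = (F x a b + F y a b + F z a b) / 3.
  by rewrite (affine_centroid (Faff a b)).
have Fcen2 x y z a b :
    F a (3^-1 *: (x + y + z)) b = (F a x b + F a y b + F a z b) / 3.
  by rewrite F12 Fcen1 !(F12 a).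
have Fcen3 x y z a b :
    F a b (3^-1 *: (x + y + z)) = (F a b x + F a b y + F a b z) / 3.
  by rewrite F23 Fcen2 !(F23 a b).
rewrite -!FP !(Fcen1, Fcen2, Fcen3) !(Fmid1, Fmid2, Fmid3).
(* Two passes of adjacent transpositions sort the arguments into the order u, v, w. *)
rewrite ?(F12 v u) ?(F12 w u) ?(F12 w v) ?(F23 _ v u) ?(F23 _ w u) ?(F23 _ w v).
rewrite ?(F12 v u) ?(F12 w u) ?(F12 w v) ?(F23 _ v u) ?(F23 _ w u) ?(F23 _ w v).
by field.
Qed.

(** The blossom of a product of three affine functions is its symmetrization, a permanent divided by
    6, which is visibly affine in each point. *)
Lemma polarization_prod (R : realType) (l : 'I_3 -> 'rV[R]_2 -> R) u v w :
  (forall s, affine_fun (l s)) ->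
  polarization (fun x => \prod_s l s x) u v w =
  (l 0 u * (l 1 v * l 2%:R w + l 1 w * l 2%:R v)
   + l 0 v * (l 1 u * l 2%:R w + l 1 w * l 2%:R u)
   + l 0 w * (l 1 v * l 2%:R u + l 1 u * l 2%:R v)) / 6.
Proof.
move=> l_aff; rewrite /polarization !big_ord_recl !big_ord0.
rewrite !(affine_mid (l_aff _)) !(affine_centroid (l_aff _)).
rewrite (_ : lift ord0 ord0 = 1); last exact: val_inj.
rewrite (_ : lift ord0 _ = 2%:R); last exact: val_inj.
rewrite (_ : ord0 = 0); last exact: val_inj.
by field.
Qed.

Lemma cubic_prod_affine (R : realType) (P : 'rV[R]_2 -> R) : cubic P ->
  exists (r : seq ('I_4 * 'I_4)) c (l : 'I_4 * 'I_4 -> 'I_3 -> 'rV[R]_2 -> R),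
    (forall i s, affine_fun (l i s)) /\
    forall x, P x = \sum_(i <- r) c i * \prod_s l i s x.
Proof.
move=> [c cE].
exists [seq i : 'I_4 * 'I_4 <- enum {: 'I_4 * 'I_4} | (i.1 + i.2 <= 3)%N].
exists (fun i : 'I_4 * 'I_4 => c i.1 i.2).
(* The monomial with exponents (a, b) gets a factors equal to the first coordinate, then b equal to
   the second; the constant 1 pads the product to exactly three factors. *)
exists (fun (i : 'I_4 * 'I_4) (s : 'I_3) (x : 'rV[R]_2) => if (s < i.1)%N then x 0 0
                     else if (s < i.1 + i.2)%N then x 0 1 else 1).
split=> [i s t x y|x].
  by case: ifP => _; first rewrite !mxE //; case: ifP => _; rewrite ?mxE //; ring.
rewrite cE big_filter big_enum_cond pair_big_dep /=; apply: eq_bigr => -[a b] /= ab.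
rewrite -mulrA; congr (_ * _); rewrite !big_ord_recl big_ord0.
case: a ab => -[|[|[|[|//]]]] ? /=; case: b => -[|[|[|[|//]]]] ? //= _; by ring.
Qed.

(** Existence of the blossom. Symmetry is read off the formula; affinity reduces by linearity in [P]
    to products of three affine functions. *)
Lemma polarization_is_blossom (R : realType) (P : 'rV[R]_2 -> R) :
  cubic P -> is_blossom P (polarization P).
Proof.
move=> /cubic_prod_affine[r [c [l [l_aff PE]]]].
split=> [x y z|x y z|y z s x y'|p].
- by rewrite /polarization [y + x]addrC [P y + P x]addrC; congr (_ / _); ring.
- by rewrite /polarization [z + y]addrC [x + z + y]addrAC; congr (_ / _); ring.
- have -> : P = fun x => \sum_(i <- r) c i * \prod_s l i s x by apply/funext.
  rewrite !polarization_lin !mulr_sumr -big_split; apply: eq_bigr => i _ /=.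
  by rewrite !polarization_prod // !l_aff; field.
- rewrite /polarization.
  have -> : 3^-1 *: (p + p + p) = p by apply: row2E; rewrite !mxE; field.
  have -> : 2^-1 *: (p + p) = p by apply: row2E; rewrite !mxE; field.
  by field.
Qed.

Lemma blossom_cubic (R : realType) (P : 'rV[R]_2 -> R) :
  cubic P -> blossom P = polarization P.
Proof.
move=> /polarization_is_blossom Pb.
by apply: polarization_blossom; apply: xgetI Pb.
Qed.

(** * Continuous differentiability of cubics *)

(* A jointly continuous divided difference gives C^1 regularity and passes to sums
   and products. *)
Definition has_continuous_slope (R : realType) (f : 'rV[R]_2 -> R) : Prop :=
  continuous f /\
  exists h : 'I_2 -> 'rV[R]_2 * 'rV[R]_2 -> R, (forall j, continuous (h j)) /\
    forall x y, f y - f x = \sum_j h j (x, y) * (y - x) 0 j.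

Lemma slope_cst (R : realType) (c : R) : has_continuous_slope (fun=> c).
Proof.
split; first by move=> ?; exact: cst_continuous.
exists (fun _ _ => 0); split=> [j x|x y]; first by move=> ?; exact: cst_continuous.
by rewrite subrr big1 // => j _; rewrite mul0r.
Qed.

Lemma slope_coord (R : realType) (k : 'I_2) :
  has_continuous_slope (fun x : 'rV[R]_2 => x 0 k).
Proof.
split; first by move=> x; apply: (@coord_continuous R 1 2 0 k).
exists (fun j _ => (j == k)%:R); split=> [j x|x y].
  by move=> ?; exact: cst_continuous.
rewrite (bigD1 k) //= eqxx mul1r big1 ?addr0 ?mxE // => j /negbTE ->.
by rewrite mul0r.
Qed.

Lemma slope_add (R : realType) (f g : 'rV[R]_2 -> R) :
  has_continuous_slope f -> has_continuous_slope g ->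
  has_continuous_slope (fun x => f x + g x).
Proof.
move=> [fc [hf [hfc hfE]]] [gc [hg [hgc hgE]]].
split; first by move=> x; apply: continuousD; [exact: fc | exact: gc].
exists (fun j z => hf j z + hg j z); split=> [j x|x y].
  by apply: continuousD; [exact: hfc | exact: hgc].
rewrite opprD addrACA hfE hgE -big_split; apply: eq_bigr => j _.
by rewrite mulrDl.
Qed.

Lemma slope_mul (R : realType) (f g : 'rV[R]_2 -> R) :
  has_continuous_slope f -> has_continuous_slope g ->
  has_continuous_slope (fun x => f x * g x).
Proof.
move=> [fc [hf [hfc hfE]]] [gc [hg [hgc hgE]]].
split; first by move=> x; apply: continuousM; [exact: fc | exact: gc].
(* Discrete product rule: [f] is taken at the second point and [g] at the first. *)
exists (fun j z => f z.2 * hg j z + g z.1 * hf j z); split=> [j x|x y].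
  have mulc (p r : 'rV[R]_2 * 'rV[R]_2 -> R) :
      continuous p -> continuous r -> continuous (fun z => p z * r z).
    by move=> pc rc z; apply: continuousM; [exact: pc | exact: rc].
  have addc (p r : 'rV[R]_2 * 'rV[R]_2 -> R) :
      continuous p -> continuous r -> continuous (fun z => p z + r z).
    by move=> pc rc z; apply: continuousD; [exact: pc | exact: rc].
  apply: addc; apply: mulc => //.
  - move=> z; apply: (@continuous_comp _ _ _ snd f); last exact: fc.
    by apply: cvg_snd.
  - move=> z; apply: (@continuous_comp _ _ _ fst g); last exact: gc.
    by apply: cvg_fst.
have -> : f y * g y - f x * g x = f y * (g y - g x) + g x * (f y - f x) by ring.
rewrite hfE hgE !mulr_sumr -big_split; apply: eq_bigr => j _ /=.
by rewrite mulrDl !mulrA.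
Qed.

(** The slope on the diagonal is the gradient: the remainder at y is the sum of (h_j(x, y) - h_j(x,
    x)) (y - x)_j, whose first factors are small near x by continuity. *)
Lemma slope_C1_on (R : realType) (D : set 'rV[R]_2) (f : 'rV[R]_2 -> R) :
  has_continuous_slope f -> C1_on D f.
Proof.
move=> [_ [h [hc hE]]].
have h_comp j (k k' : 'rV[R]_2 -> 'rV[R]_2) : continuous k -> continuous k' ->
    continuous (fun x => h j (k x, k' x)).
  move=> kc k'c x.
  have hjE : h j = fun z => h j (z.1, z.2) by apply/funext => -[].
  apply: (@continuous2_cvg _ _ _ _ (nbhs x) (nbhs_filter x) k k'
            (fun u v => h j (u, v)) (k x) (k' x)).
  - by have := hc j (k x, k' x); rewrite /continuous_at {1}hjE; apply.
  - exact: kc.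
  - exact: k'c.
have id_cont : continuous (fun x : 'rV[R]_2 => x) by move=> x; apply: cvg_id.
have cst_cont (x : 'rV[R]_2) : continuous (fun _ : 'rV[R]_2 => x).
  by move=> ?; exact: cst_continuous.
exists (fun x => \row_j h j (x, x)); split.
  apply: continuous_subspaceT => x; apply/(@cvg_ballP _ _ _ _ (nbhs_filter x)) => e e0.
  have : \forall y \near x, forall j : 'I_2, ball (h j (x, x)) e (h j (y, y)).
    apply: (@filter_forall _ _ _ (nbhs x) (nbhs_filter x)) => j.
    have /(@cvg_ballP _ _ _ _ (nbhs_filter x)) := h_comp j _ _ id_cont id_cont x.
    exact.
  by apply: filterS => y hy; split => // i j; rewrite !mxE.
move=> x _ e e0; rewrite near_withinE.
(* There are two coordinates, each at most the sup norm of y - x, hence the tolerance [e / 2] for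
   each. *)
have : \forall y \near x, forall j : 'I_2, ball (h j (x, x)) (e / 2) (h j (x, y)).
  apply: (@filter_forall _ _ _ (nbhs x) (nbhs_filter x)) => j.
  have /(@cvg_ballP _ _ _ _ (nbhs_filter x)) := h_comp j _ _ (cst_cont x) id_cont x.
  apply.
  exact: divr_gt0.
apply: filterS => y hy _.
have -> : (\row_j h j (x, x) *m (y - x)^T) 0 0 = \sum_j h j (x, x) * (y - x) 0 j.
  by rewrite mxE; apply: eq_bigr => j _; rewrite !mxE.
rewrite hE -sumrB (splitr e) mulrDl.
apply: (le_trans (ler_norm_sum _ _ _)).
have hj j : `|h j (x, y) * (y - x) 0 j - h j (x, x) * (y - x) 0 j|
              <= e / 2 * `|y - x|.
  rewrite -mulrBl normrM distrC; apply: ler_pM => //; first by apply/ltW/hy.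
  rewrite {2}/Num.norm /= mx_normrE.
  exact: (le_bigmax _ (fun ij : 'I_1 * 'I_2 => `|(y - x) ij.1 ij.2|) (0, j)).
by rewrite !big_ord_recl big_ord0 addr0; apply: lerD; apply: hj.
Qed.

Lemma cubic_C1_on (R : realType) (D : set 'rV[R]_2) (P : 'rV[R]_2 -> R) :
  cubic P -> C1_on D P.
Proof.
move=> [c cE]; apply: slope_C1_on.
have -> : P = fun x => \sum_(a < 4) \sum_(b < 4 | (a + b <= 3)%N)
                c a b * x 0 0 ^+ a * x 0 1 ^+ b by apply/funext.
have slope_sum (I : Type) (r : seq I) (Q : pred I) (f : I -> 'rV[R]_2 -> R) :
    (forall i, has_continuous_slope (f i)) ->
    has_continuous_slope (fun x => \sum_(i <- r | Q i) f i x).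
  move=> fs; elim: r => [|i r IH].
    by under eq_fun do rewrite big_nil; exact: slope_cst.
  under eq_fun do rewrite big_cons.
  by case: (Q i) => //; apply: slope_add.
have slope_exp k n : has_continuous_slope (fun x : 'rV[R]_2 => x 0 k ^+ n).
  elim: n => [|n IH]; first exact: slope_cst.
  by under eq_fun do rewrite exprS; apply: slope_mul => //; exact: slope_coord.
apply: (slope_sum) => a; apply: (slope_sum) => b.
by apply: slope_mul => //; apply: slope_mul => //; exact: slope_cst.
Qed.

(** * Plane geometry of a triangle and vanishing of cubics on it *)

(** Twice the signed area of the triangle with vertices a, b, c. *)
Definition cross (R : realType) (a b c : 'rV[R]_2) : R :=
  (b 0 0 - a 0 0) * (c 0 1 - a 0 1) - (b 0 1 - a 0 1) * (c 0 0 - a 0 0).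

Lemma cross_neq0 (R : realType) (a b c : 'rV[R]_2) :
  ~ collinear a b c -> cross a b c != 0.
Proof.
apply: contra_notN => /eqP abc0.
have [ab|ab] := eqVneq a b.
  exists a, (c - a) => x; rewrite -ab !inE => /or3P[] /eqP ->.
  - by exists 0; rewrite scale0r addr0.
  - by exists 0; rewrite scale0r addr0.
  - by exists 1; rewrite scale1r addrC subrK.
exists a, (b - a) => x; rewrite !inE => /or3P[] /eqP ->.
- by exists 0; rewrite scale0r addr0.
- by exists 1; rewrite scale1r addrC subrK.
(* The parameter of c on the line through a and b is read off a coordinate in which a and b
   differ. *)
have [b0|b0] := eqVneq (b 0 0 - a 0 0) 0.
  have b1 : b 0 1 - a 0 1 != 0.
    apply: contra_neq ab => b1; apply: row2E; apply/esym/subr0_eq => //.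
  exists ((c 0 1 - a 0 1) / (b 0 1 - a 0 1)); apply: row2E; rewrite !mxE.
    move: abc0; rewrite /cross b0 mul0r sub0r => /eqP.
    rewrite oppr_eq0 mulf_eq0 (negbTE b1) /= subr_eq0 => /eqP ->.
    by rewrite mulr0 addr0.
  by rewrite divfK // addrC subrK.
exists ((c 0 0 - a 0 0) / (b 0 0 - a 0 0)); apply: row2E; rewrite !mxE.
  by rewrite divfK // addrC subrK.
move: abc0; rewrite /cross => /subr0_eq /(canRL (mulKf b0)) => e.
rewrite -[c 0 1](subrK (a 0 1)) e.
by field.
Qed.

(** Cramer's rule, with [cross a b c] as determinant. *)
Lemma barycentric (R : realType) (a b c x : 'rV[R]_2) : cross a b c != 0 ->
  exists al be ga, al + be + ga = 1 /\ x = al *: a + be *: b + ga *: c.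
Proof.
rewrite /cross => abc0.
pose d := (b 0 0 - a 0 0) * (c 0 1 - a 0 1) - (b 0 1 - a 0 1) * (c 0 0 - a 0 0).
pose be := ((x 0 0 - a 0 0) * (c 0 1 - a 0 1) - (x 0 1 - a 0 1) * (c 0 0 - a 0 0)) / d.
pose ga := ((b 0 0 - a 0 0) * (x 0 1 - a 0 1) - (b 0 1 - a 0 1) * (x 0 0 - a 0 0)) / d.
exists (1 - be - ga), be, ga; split; first by ring.
by apply: row2E; rewrite !mxE /be /ga /d; field.
Qed.

Lemma hull3P (R : realType) (a b c x : 'rV[R]_2) :
  hull [:: a; b; c] x <->
  exists al be ga, [/\ 0 <= al, 0 <= be, 0 <= ga, al + be + ga = 1
    & x = al *: a + be *: b + ga *: c].
Proof.
split=> [[w [w0 w1 ->]]|[al [be [ga [al0 be0 ga0 s1 ->]]]]].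
  move: w1; rewrite !big_ord_recl !big_ord0 !addr0 !addrA => w1.
  by eexists _, _, _; split; last by []; try exact: w0.
exists (fun l => [:: al; be; ga]`_l); split.
- by case=> -[|[|[|//]]].
- by rewrite !big_ord_recl !big_ord0 /= !addr0 addrA.
- by rewrite !big_ord_recl !big_ord0 /= !addr0 addrA.
Qed.

(** Midpoints and centroids are the points, besides the arguments themselves, at which
    [polarization] evaluates its polynomial. *)
Lemma hull3_mid (R : realType) (a b c x y : 'rV[R]_2) :
  hull [:: a; b; c] x -> hull [:: a; b; c] y -> hull [:: a; b; c] (2^-1 *: (x + y)).
Proof.
move=> /hull3P[p [q [r [p0 q0 r0 s1 ->]]]] /hull3P[p' [q' [r' [p0' q0' r0' s1' ->]]]].
apply/hull3P; exists ((p + p') / 2), ((q + q') / 2), ((r + r') / 2).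
split; rewrite ?divr_ge0 ?addr_ge0 //; first by lra.
by apply: row2E; rewrite !mxE; field.
Qed.

Lemma hull3_centroid (R : realType) (a b c x y z : 'rV[R]_2) :
  hull [:: a; b; c] x -> hull [:: a; b; c] y -> hull [:: a; b; c] z ->
  hull [:: a; b; c] (3^-1 *: (x + y + z)).
Proof.
move=> /hull3P[p [q [r [p0 q0 r0 s1 ->]]]] /hull3P[p' [q' [r' [p0' q0' r0' s1' ->]]]].
move=> /hull3P[p2 [q2 [r2 [p02 q02 r02 s12 ->]]]].
apply/hull3P; exists ((p + p' + p2) / 3), ((q + q' + q2) / 3), ((r + r' + r2) / 3).
split; rewrite ?divr_ge0 ?addr_ge0 //; first by lra.
by apply: row2E; rewrite !mxE; field.
Qed.

(* The blossom vanishes at all triples of points of the triangle, hence at the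
   triples of its vertices, hence everywhere since it is affine in each argument. *)
Lemma cubic_eq0 (R : realType) (P : 'rV[R]_2 -> R) (a b c : 'rV[R]_2) :
  cubic P -> cross a b c != 0 -> (forall x, hull [:: a; b; c] x -> P x = 0) ->
  P = fun=> 0.
Proof.
move=> /polarization_is_blossom[F12 F23 Faff FP] abc0 P0.
have F0 u v w : hull [:: a; b; c] u -> hull [:: a; b; c] v ->
    hull [:: a; b; c] w -> polarization P u v w = 0.
  move=> hu hv hw; rewrite /polarization !P0 //; try exact: hull3_mid.
    by field.
  exact: hull3_centroid.
have ha : hull [:: a; b; c] a.
  by apply/hull3P; exists 1, 0, 0; rewrite !scale0r scale1r !addr0.
have hb : hull [:: a; b; c] b.
  by apply/hull3P; exists 0, 1, 0; rewrite !scale0r scale1r !addr0 !add0r.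
have hc : hull [:: a; b; c] c.
  by apply/hull3P; exists 0, 0, 1; rewrite !scale0r scale1r !addr0 !add0r.
have extend v w : polarization P a v w = 0 -> polarization P b v w = 0 ->
    polarization P c v w = 0 -> forall x, polarization P x v w = 0.
  move=> ea eb ec x; have [p [q [r [pqr ->]]]] := barycentric x abc0.
  by rewrite (affine_comb3 (Faff v w)) // ea eb ec; ring.
have F1 x v w : hull [:: a; b; c] v -> hull [:: a; b; c] w ->
    polarization P x v w = 0.
  by move=> hv hw; apply: extend; exact: F0.
have F2 x y w : hull [:: a; b; c] w -> polarization P x y w = 0.
  by move=> hw; rewrite F12; apply: extend; rewrite F12; exact: F1.
have F3 x y z : polarization P x y z = 0.
  by rewrite F23 F12; apply: extend; rewrite F12 F23; exact: F2.
by apply/funext => x; rewrite -FP F3.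
Qed.

(** * Convex weights indexed by vertices, and sums over small sets *)

(** The weights in [hull] are indexed by list positions; in a list without repetition the position
    of an element is determined, so they can be carried over to the elements. *)
Lemma map_seq_weights (R : realType) (I : eqType) (v : I -> 'rV[R]_2) (s : seq I)
    (a : 'I_(size (map v s)) -> R) : uniq s ->
  exists w : I -> R, [/\ forall i, i \in s -> exists l, w i = a l,
     \sum_(i <- s) w i = \sum_l a l
   & \sum_(i <- s) w i *: v i = \sum_l a l *: (map v s)`_l].
Proof.
move=> s_uniq.
(* The default 0 is taken only outside [s]. *)
pose w i := oapp a 0 (insub (index i s)).
have wE i (si : (index i s < size (map v s))%N) : w i = a (Ordinal si).
  by rewrite /w insubT.
exists w; split.
- move=> i si; have ix : (index i s < size (map v s))%N by rewrite size_map index_mem.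
  by exists (Ordinal ix); rewrite wE.
- case: s s_uniq a w wE => [|i0 s] s_uniq a w wE; first by rewrite big_nil big_ord0.
  rewrite (big_nth i0) big_mkord -(size_map v); apply: eq_bigr => l _.
  have ls : (l < size (i0 :: s))%N by rewrite -(size_map v).
  have ix : (index (nth i0 (i0 :: s) l) (i0 :: s) < size (map v (i0 :: s)))%N.
    by rewrite index_uniq.
  by rewrite wE; congr a; apply: val_inj; exact: (index_uniq i0 ls s_uniq).
- case: s s_uniq a w wE => [|i0 s] s_uniq a w wE; first by rewrite big_nil big_ord0.
  rewrite (big_nth i0) big_mkord -(size_map v); apply: eq_bigr => l _.
  have ls : (l < size (i0 :: s))%N by rewrite -(size_map v).
  have ix : (index (nth i0 (i0 :: s) l) (i0 :: s) < size (map v (i0 :: s)))%N.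
    by rewrite index_uniq.
  rewrite (nth_map i0) // wE; congr (a _ *: _).
  by apply: val_inj; exact: (index_uniq i0 ls s_uniq).
Qed.

Lemma inside_weights (R : realType) (I : finType) (v : I -> 'rV[R]_2)
    (A : {set I}) (x : 'rV[R]_2) : inside [seq v i | i in A] x ->
  exists w : I -> R, [/\ forall i, i \in A -> 0 < w i,
     \sum_(i in A) w i = 1 & x = \sum_(i in A) w i *: v i].
Proof.
move=> [a [a0 a1 ->]].
have [w [w0 w1 wx]] := map_seq_weights a (enum_uniq (mem A)).
exists w; split.
- by move=> i iA; have [|l ->] := w0 i; rewrite ?mem_enum.
- by rewrite -a1 -w1 big_enum.
- by rewrite -wx big_enum.
Qed.

Lemma faceI (R : realType) (I : finType) (v : I -> 'rV[R]_2) (A : {set I})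
    (w : I -> R) : (forall i, 0 <= w i) -> \sum_(i in A) w i = 1 ->
  face v A (\sum_(i in A) w i *: v i).
Proof.
move=> w0 w1.
(* An empty sum cannot be 1; the element found serves as the default of [nth]. *)
have [i0 _] : exists i, i \in A.
  apply/set0Pn/eqP => A0; move: w1; rewrite A0 big_set0 => /esym/eqP.
  by rewrite oner_eq0.
exists (fun l => w (nth i0 (enum A) l)); split=> //.
  rewrite -w1 -[RHS]big_enum (big_nth i0) big_mkord.
  by rewrite -[in RHS](size_map v).
rewrite -[LHS]big_enum (big_nth i0) big_mkord -(size_map v).
by apply: eq_bigr => l _; rewrite (nth_map i0) // -(size_map v).
Qed.

Lemma sum_set3 (V : nmodType) (I : finType) (F : I -> V) (i j k : I) :
  #|[set i; j; k]%SET| = 3%N ->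
  \sum_(l in [set i; j; k]%SET) F l = F i + F j + F k.
Proof.
rewrite finset.setUC cardsU1 cards2.
case: (boolP (k \notin _)) => [kij|_]; last by case: (i != j).
case: (boolP (i != j)) => // ij _.
by rewrite big_setU1 //= big_setU1 ?inE //= big_set1 addrC.
Qed.

Lemma sum_set2 (V : nmodType) (I : finType) (F : I -> V) (i j : I) :
  i != j -> \sum_(l in [set i; j]%SET) F l = F i + F j.
Proof. by move=> ij; rewrite big_setU1 ?inE //= big_set1. Qed.

Lemma set3_rot (I : finType) (i j k : I) : [set i; j; k]%SET = [set j; k; i]%SET.
Proof. by apply/finset.setP => l; rewrite !inE -orbA orbC. Qed.

(** * Combinatorics and geometry of the refined triangulation *)

Section Refinement.
Variables (R : realType) (Omega : set 'rV[R]_2) (D : triangulation Omega).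
Implicit Types (i j k : vidx D) (e t : {set vidx D}).

Lemma tri_distinct i j k : [set i; j; k]%SET \in tris D ->
  [/\ i != j, k != i & k != j].
Proof.
move=> /tris_card; rewrite finset.setUC cardsU1 cards2 !inE negb_or.
by case: (i != j); case: (k != i); case: (k != j).
Qed.

Lemma tri_edge i j k : [set i; j; k]%SET \in tris D -> [set i; j]%SET \in edges D.
Proof.
move=> T; apply/edgesP; split; last by exists [set i; j; k]%SET; rewrite ?finset.subsetUl.
by have [ij _ _] := tri_distinct T; rewrite cards2 ij.
Qed.

Lemma edge_distinct i j : [set i; j]%SET \in edges D -> i != j.
Proof. by move=> /edgesP[]; rewrite cards2; case: (i != j). Qed.

(** The map from k to the set of i, j, k is a bijection onto the attached triangles, so the counts
    assumed for triangles become counts of third indices. *)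
Lemma card_apexes i j : [set i; j]%SET \in edges D ->
  #|[set k | [set i; j; k]%SET \in tris D]%SET|
    = #|attached (tris D) [set i; j]%SET|.
Proof.
move=> ijE; have /edgesP[ij2 _] := ijE.
rewrite -(@card_in_imset _ _ (fun k => [set i; j; k]%SET)).
  congr #|pred_of_set _|; apply/finset.setP => t; rewrite !inE; apply/imsetP/andP.
    by move=> [k]; rewrite inE => T ->; rewrite T finset.subsetUl.
  move=> [T ijt]; have : #|t :\: [set i; j]%SET| == 1%N.
    by rewrite cardsDS // tris_card // ij2.
  move=> /cards1P[k tk].
  have tE : t = [set i; j; k]%SET.
    by rewrite -tk -{1}(finset.setID t [set i; j]%SET) (finset.setIidPr ijt).
  by exists k; rewrite ?inE -?tE.
move=> k k'; rewrite !inE => T T' kk'; apply/eqP.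
have : k \in [set i; j; k']%SET by rewrite -kk' !inE eqxx orbT.
have [_ /negbTE ki /negbTE kj] := tri_distinct T.
by rewrite !inE ki kj.
Qed.

Lemma bedge_edge e : e \in bedges D -> e \in edges D.
Proof. by rewrite inE => /andP[]. Qed.

Lemma bedge_apex i j k : [set i; j]%SET \in bedges D ->
  ([set i; j; k]%SET \in tris D) = (k == opposite i j).
Proof.
move=> ijB.
have /eqP/cards1P[k0 k0E] := etrans (card_apexes (bedge_edge ijB)) (boundary_edge ijB).
have TE l : ([set i; j; l]%SET \in tris D) = (l == k0).
  by move/finset.setP/(_ l): k0E; rewrite !inE.
rewrite TE /opposite; case: pickP => [l|/(_ k0)]; rewrite TE; first by move/eqP->.
by rewrite eqxx.
Qed.

Lemma iedge_apex i j : [set i; j]%SET \in edges D :\: bedges D ->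
  exists k0 k1, k0 != k1 /\
    forall k, ([set i; j; k]%SET \in tris D) = (k == k0) || (k == k1).
Proof.
move=> ijI; have ijE : [set i; j]%SET \in edges D by move: ijI; rewrite inE => /andP[].
have /eqP/cards2P[k0 [k1 [k01 kE]]] := etrans (card_apexes ijE) (interior_edge ijI).
by exists k0, k1; split=> // k; move/finset.setP/(_ k): kE; rewrite !inE.
Qed.

Variable PS : powell_sabin D.

Lemma esplit_comb i j : [set i; j]%SET \in edges D ->
  exists2 s, 0 < s < 1 & esplit PS [set i; j]%SET = (1 - s) *: vtx i + s *: vtx j.
Proof.
move=> ijE; have ij := edge_distinct ijE.
have [w [w0]] := inside_weights (esplit_inside PS ijE).
rewrite !sum_set2 // => w1 ->.
have wi : 0 < w i by apply: w0; rewrite !inE eqxx.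
have wj : 0 < w j by apply: w0; rewrite !inE eqxx orbT.
exists (w j); first by apply/andP; split; lra.
by rewrite -w1 addrK.
Qed.

Lemma tsplit_comb i j k : [set i; j; k]%SET \in tris D ->
  exists al be ga, [/\ 0 < al, 0 < be, 0 < ga, al + be + ga = 1 &
    tsplit PS [set i; j; k]%SET = al *: vtx i + be *: vtx j + ga *: vtx k].
Proof.
move=> T; have [w [w0]] := inside_weights (tsplit_inside PS T).
rewrite !sum_set3 ?tris_card // => w1 ->.
by exists (w i), (w j), (w k); split; rewrite ?w0 // !inE eqxx ?orbT.
Qed.

(** The area of the small triangle is that of the large one times the weight of [vtx j] in the edge
    point and the weight of [vtx k] in the inner point, both positive. *)
Lemma ps_tri_cross i j k : [set i; j; k]%SET \in tris D ->
  cross (vtx i) (esplit PS [set i; j]%SET) (tsplit PS [set i; j; k]%SET) != 0.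
Proof.
move=> T; have [s /andP[s0 _] ->] := esplit_comb (tri_edge T).
have [al [be [ga [_ _ ga0 s1 ->]]]] := tsplit_comb T.
have -> : cross (vtx i) ((1 - s) *: vtx i + s *: vtx j)
    (al *: vtx i + be *: vtx j + ga *: vtx k)
    = s * ga * cross (vtx i) (vtx j) (vtx k).
  by have -> : al = 1 - be - ga by [lra]; rewrite /cross !mxE; ring.
rewrite !mulf_neq0 ?(gt_eqF s0) ?(gt_eqF ga0) // cross_neq0 //.
exact: tris_nondegenerate.
Qed.

Lemma ps_tri_sub i j k : [set i; j; k]%SET \in tris D -> ps_tri PS i j k `<=` Omega.
Proof.
move=> T x /hull3P[p [q [r [p0 q0 r0 pqr ->]]]].
have [s /andP[s0 s1] ->] := esplit_comb (tri_edge T).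
have [al [be [ga [al0 be0 ga0 abc ->]]]] := tsplit_comb T.
have [ij ki kj] := tri_distinct T.
have cover y : face (@vtx _ _ D) [set i; j; k]%SET y -> Omega y.
  by move=> ty; rewrite [X in X y](tris_cover D); exists [set i; j; k]%SET.
apply: cover.
(* Substituting both split points and collecting by vertex gives these weights. The last branch is
   meant for k; elsewhere it only keeps [w] nonnegative, as [faceI] requires. *)
pose w l := if l == i then p + q * (1 - s) + r * al
  else if l == j then q * s + r * be else r * ga.
have [wi wj wk] : [/\ w i = p + q * (1 - s) + r * al, w j = q * s + r * be
    & w k = r * ga].
  by rewrite /w !eqxx (negbTE ki) (negbTE kj) [j == i]eq_sym (negbTE ij).
have -> : p *: vtx i + q *: ((1 - s) *: vtx i + s *: vtx j)
    + r *: (al *: vtx i + be *: vtx j + ga *: vtx k)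
    = \sum_(l in [set i; j; k]%SET) w l *: vtx l.
  rewrite sum_set3 ?tris_card // wi wj wk.
  by apply: row2E; rewrite !mxE; ring.
apply: faceI.
  have s1' : 0 <= 1 - s by lra.
  move=> l; rewrite /w; case: ifP => _; last case: ifP => _;
    by rewrite ?addr_ge0 ?mulr_ge0 // ltW.
rewrite sum_set3 ?tris_card // wi wj wk.
have -> : al = 1 - be - ga by lra.
by rewrite -[RHS]pqr; ring.
Qed.

(** * Polynomial pieces, the functionals and the dual expansion *)

Lemma cubic_unique (P Q : 'rV[R]_2 -> R) i j k : [set i; j; k]%SET \in tris D ->
  cubic P -> cubic Q -> (forall x, ps_tri PS i j k x -> P x = Q x) -> P = Q.
Proof.
move=> T Pc Qc PQ.
(* P - Q is written as a signed sum over the booleans, so that [cubic_lin] applies. *)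
pose p (b : bool) := if b then P else Q.
have pc b : cubic (p b) by case: b.
have := cubic_lin [:: true; false] (fun b : bool => (-1) ^+ ~~ b) pc.
move=> /cubic_eq0/(_ (ps_tri_cross T)) PQ0.
have subE x : \sum_(b <- [:: true; false]) (-1) ^+ (~~ b) * p b x = P x - Q x.
  by rewrite !big_cons big_nil /=; ring.
apply/funext => x; apply/subr0_eq; rewrite -subE; apply: (congr1 (@^~ x) (PQ0 _)) => y ty.
by rewrite subE PQ // subrr.
Qed.

Lemma piece_eq (S P : 'rV[R]_2 -> R) i j k : [set i; j; k]%SET \in tris D ->
  cubic P -> (forall x, ps_tri PS i j k x -> S x = P x) ->
  piece S (ps_tri PS i j k) = P.
Proof.
move=> T Pc SP; rewrite /piece; case: xgetP => [Q -> [Qc SQ]|/(_ P)[]//].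
by apply: (cubic_unique T) => // x tx; rewrite -SQ // SP.
Qed.

Lemma piece_cubic (S : 'rV[R]_2 -> R) i j k :
  spline_space PS S -> [set i; j; k]%SET \in tris D ->
  cubic (piece S (ps_tri PS i j k)) /\
  forall x, ps_tri PS i j k x -> S x = piece S (ps_tri PS i j k) x.
Proof.
by move=> [_ /(_ i j k) S3] T; have [P Pc SP] := S3 T; rewrite (piece_eq T Pc SP).
Qed.

(** The same combination of the pieces is a cubic that agrees with [P] on the small triangle, so by
    uniqueness it is the piece of [P]; [polarization] is linear in the polynomial. *)
Lemma blossom_piece_lin (n : nat) (c : 'I_n -> R) (S : 'I_n -> 'rV[R]_2 -> R)
    (P : 'rV[R]_2 -> R) i j k u v w :
  [set i; j; k]%SET \in tris D -> (forall l, spline_space PS (S l)) ->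
  (forall x, Omega x -> P x = \sum_l c l * S l x) ->
  blossom (piece P (ps_tri PS i j k)) u v w =
  \sum_l c l * blossom (piece (S l) (ps_tri PS i j k)) u v w.
Proof.
move=> T Ss PE.
have Sc l := piece_cubic (Ss l) T.
have sc := cubic_lin (index_enum 'I_n) c (fun l => (Sc l).1).
rewrite (piece_eq T sc) ?blossom_cubic ?polarization_lin //; last first.
  move=> x tx; rewrite PE; last exact: ps_tri_sub tx.
  by apply: eq_bigr => l _; rewrite (Sc l).2.
by apply: eq_bigr => l _; rewrite blossom_cubic //; exact: (Sc l).1.
Qed.

Variables (q : vidx D -> 'I_3 -> 'rV[R]_2) (nb : vidx D -> vidx D * vidx D).
Hypothesis nb_tri : forall i, [set i; (nb i).1; (nb i).2]%SET \in tris D.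

Lemma beta_lin (n : nat) (c : 'I_n -> R) (S : 'I_n -> 'rV[R]_2 -> R)
    (P : 'rV[R]_2 -> R) a :
  valid_fidx a -> (forall l, spline_space PS (S l)) ->
  (forall x, Omega x -> P x = \sum_l c l * S l x) ->
  beta PS q nb a P = \sum_l c l * beta PS q nb a (S l).
Proof.
case: a => [i r|i j k|i j] /= av Ss PE; apply: blossom_piece_lin => //.
by rewrite bedge_apex.
Qed.

Definition fidx_point (a : fidx (vidx D)) : 'rV[R]_2 * 'rV[R]_2 * 'rV[R]_2 :=
  match a with
  | Fv i r => (vtx i, vtx i, vtx i + 3 *: (q i r - vtx i))
  | Ft i j k => (vtx i, vtx j, tsplit PS [set i; j; k]%SET)
  | Fe i j => (vtx i, vtx j, esplit PS [set i; j]%SET)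
  end.

(** Every piece of a cubic is the cubic itself, so only the arguments of the blossom depend on the
    index. *)
Lemma beta_cubic (P : 'rV[R]_2 -> R) a : cubic P -> valid_fidx a ->
  beta PS q nb a P =
  polarization P (fidx_point a).1.1 (fidx_point a).1.2 (fidx_point a).2.
Proof.
move=> Pc; case: a => [i r|i j k|i j] /= av; rewrite (piece_eq _ Pc) ?blossom_cubic //.
by rewrite bedge_apex.
Qed.

Lemma cubic_spline (P : 'rV[R]_2 -> R) : cubic P -> spline_space PS P.
Proof. by move=> Pc; split; [exact: cubic_C1_on | move=> i j k T; exists P]. Qed.

(** A presentation of the indices by a sum type, over which finite sums can range when [I] is
    finite. *)
Definition fidx_of_sum (I : Type) (s : (I * 'I_3) + ((I * I * I) + (I * I))) : fidx I :=
  match s with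
  | inl p => Fv p.1 p.2
  | inr (inl p) => Ft p.1.1 p.1.2 p.2
  | inr (inr p) => Fe p.1 p.2
  end.

Lemma fidx_of_sum_surj (I : Type) (a : fidx I) : exists s, a = fidx_of_sum s.
Proof.
by case: a => [i r|i j k|i j];
  [exists (inl (i, r)) | exists (inr (inl (i, j, k))) | exists (inr (inr (i, j)))].
Qed.

Lemma fidx_of_sum_inj (I : Type) : injective (@fidx_of_sum I).
Proof.
by case=> [[i r]|[[[i j] k]|[i j]]] [[i' r']|[[[i' j'] k']|[i' j']]] //= [] *; subst.
Qed.

(** Spanning gives some combination of the basis functions; applying a functional to it and using
    duality identifies the coefficients. *)
Lemma dual_expansion (B : fidx (vidx D) -> 'rV[R]_2 -> R) (P : 'rV[R]_2 -> R) x :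
  is_dual_basis PS q nb B -> spline_space PS P -> Omega x ->
  P x = \sum_(s | valid_fidx (fidx_of_sum s))
          beta PS q nb (fidx_of_sum s) P * B (fidx_of_sum s) x.
Proof.
move=> [Bs Bspan B1 B0] /Bspan[n [c [g [gB PE]]]] xO.
have /choice[s sP] : forall l, exists s : _ + (_ + _),
    valid_fidx (fidx_of_sum s) /\ g l = B (fidx_of_sum s).
  by move=> l; have [a av <-] := gB l; have [s sE] := fidx_of_sum_surj a;
    exists s; rewrite -sE.
have gs l : spline_space PS (g l) by rewrite (sP l).2; apply: Bs; exact: (sP l).1.
(* The combination may list a basis function several times, so its terms are grouped by index. *)
rewrite PE // (partition_big s (fun s => valid_fidx (fidx_of_sum s))) /=; last first.
  by move=> l _; exact: (sP l).1.
apply: eq_bigr => t tv; rewrite (beta_lin tv gs PE) mulr_suml.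
rewrite [LHS]big_mkcond; apply: eq_bigr => l _; rewrite (sP l).2.
case: eqP => [->|st]; first by rewrite B1 // mulr1.
rewrite B0 ?mulr0 ?mul0r //; first exact: (sP l).1.
by move/fidx_of_sum_inj => ts; apply: st.
Qed.

End Refinement.

(** * Closure properties of the span *)

Lemma span_add_scale (R : realType) (Omega : set 'rV[R]_2) (G : set ('rV[R]_2 -> R))
    a f h :
  span_on Omega G f -> span_on Omega G h -> span_on Omega G (fun x => a * f x + h x).
Proof.
move=> [n [c [g [gG fE]]]] [m [c' [g' [g'G hE]]]].
exists (n + m)%N,
  (fun l => match fintype.split l with inl l => a * c l | inr l => c' l end),
  (fun l => match fintype.split l with inl l => g l | inr l => g' l end).
split=> [l|x xO]; first by case: fintype.split.
rewrite fE // hE // big_split_ord mulr_sumr; congr (_ + _); apply: eq_bigr => l _.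
  by rewrite (unsplitK (inl l)) mulrA.
by rewrite (unsplitK (inr l)).
Qed.

Lemma span_lin (R : realType) (Omega : set 'rV[R]_2) (G : set ('rV[R]_2 -> R))
    (I : Type) (r : seq I) (Q : pred I) (c : I -> R) (f : I -> 'rV[R]_2 -> R) :
  (forall i, Q i -> G (f i)) ->
  span_on Omega G (fun x => \sum_(i <- r | Q i) c i * f i x).
Proof.
move=> fG; elim: r => [|i r IH].
  exists 0%N, (fun=> 0), (fun _ _ => 0); split=> [[]//|x _].
  by rewrite big_nil big_ord0.
under eq_fun do rewrite big_cons; case Qi: (Q i) => //.
apply: span_add_scale => //; exists 1%N, (fun=> 1), (fun=> f i).
by split=> [l|x _]; [exact: fG | rewrite big_ord1 mul1r].
Qed.

Lemma eq_span (R : realType) (Omega : set 'rV[R]_2) (G : set ('rV[R]_2 -> R)) f h :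
  (forall x, Omega x -> f x = h x) -> span_on Omega G h -> span_on Omega G f.
Proof.
move=> fh [n [c [g [gG hE]]]]; exists n, c, g; split=> // x xO.
by rewrite fh // hE.
Qed.

Lemma span_add (R : realType) (Omega : set 'rV[R]_2) (G : set ('rV[R]_2 -> R)) f h :
  span_on Omega G f -> span_on Omega G h -> span_on Omega G (fun x => f x + h x).
Proof.
by move=> Gf Gh; under eq_fun do rewrite -[f _]mul1r; exact: span_add_scale.
Qed.

(** * Sums over triangles with ordered indices *)

Section TriangleSums.
Variables (V : nmodType) (I : finType) (A : {set {set I}}).
Implicit Types G : I -> I -> I -> V.

(** Each three-element set of [A] is met six times, once per order of its indices, so permuting
    indices is a change of summation variables. *)
Definition sum_tri G : V := \sum_i \sum_j \sum_(k | [set i; j; k]%SET \in A) G i j k.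

Lemma eq_sum_tri G G' :
  (forall i j k, [set i; j; k]%SET \in A -> G i j k = G' i j k) ->
  sum_tri G = sum_tri G'.
Proof.
by move=> GG'; do 2!apply: eq_bigr => ? _; apply: eq_bigr => k; apply: GG'.
Qed.

Lemma sum_triD G G' :
  sum_tri (fun i j k => G i j k + G' i j k) = sum_tri G + sum_tri G'.
Proof.
by rewrite -big_split; apply: eq_bigr => i _; rewrite -big_split;
  apply: eq_bigr => j _; rewrite -big_split.
Qed.

Lemma sum_tri_swap G : sum_tri G = sum_tri (fun i j k => G j i k).
Proof.
rewrite /sum_tri exchange_big; do 2!apply: eq_bigr => ? _.
by apply: eq_bigl => k; rewrite [[set _; _]%SET]finset.setUC.
Qed.

Lemma sum_tri_rot G : sum_tri G = sum_tri (fun i j k => G j k i).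
Proof.
(* Moving the condition into the summand makes the three ranges independent, so the sums can be
   exchanged. *)
have mk G' : sum_tri G' =
    \sum_i \sum_j \sum_k if [set i; j; k]%SET \in A then G' i j k else 0.
  by do 2!apply: eq_bigr => ? _; rewrite big_mkcond.
rewrite !mk; under eq_bigr do rewrite exchange_big.
rewrite exchange_big; do 3!apply: eq_bigr => ? _.
by rewrite -set3_rot.
Qed.

Lemma sum_triE G :
  sum_tri G = \sum_(p : I * I * I | [set p.1.1; p.1.2; p.2]%SET \in A)
                  G p.1.1 p.1.2 p.2.
Proof. by rewrite /sum_tri pair_bigA pair_big_dep. Qed.

End TriangleSums.

Lemma sum_tri_split (V : nmodType) (I : finType) (A A' : {set {set I}})
    (G : I -> I -> I -> V) : A' \subset A ->
  sum_tri A G = sum_tri (A :\: A') G + sum_tri A' G.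
Proof.
move=> A'A; rewrite 3!sum_triE.
rewrite (bigID (fun p => [set p.1.1; p.1.2; p.2]%SET \in A')) /= addrC.
congr (_ + _); apply: eq_bigl => p; first by rewrite inE andbC.
by apply: andb_idl; exact: (fintype.subsetP A'A).
Qed.

(** * Regrouping the expansion edge by edge *)

Section Regrouping.
Variables (R : realType) (Omega : set 'rV[R]_2) (D : triangulation Omega)
  (PS : powell_sabin D) (om : {set vidx D} -> vidx D -> R).
Hypothesis om_weights : is_weights PS om.
Variable F : vidx D -> vidx D -> 'rV[R]_2 -> R.
Hypothesis F_affine : forall i j, affine_fun (F i j).
Hypothesis F_sym : forall i j w, F i j w = F j i w.
Variables (B : fidx (vidx D) -> 'rV[R]_2 -> R) (x : 'rV[R]_2).
Implicit Types i j k : vidx D.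

(* The terms of B^e_{ij,k} whose functions have first index i. *)
Let Bhalf i j k :=
  (1 - om [set i; j]%SET k) * B (Ft i j k) x
  + \sum_(k' | (k' != k) && ([set i; j; k']%SET \in tris D))
      om [set i; j]%SET k' * B (Ft i j k') x.

Lemma Be_tri_halves i j k : Be_tri B om i j k x = Bhalf i j k + Bhalf j i k.
Proof.
rewrite /Be_tri /Bhalf [[set j; i]%SET]finset.setUC addrACA -mulrDr -big_split.
by congr (_ + _); apply: eq_bigr => k' _; rewrite mulrDr.
Qed.

Lemma wpt_sym i j k : wpt PS i j k = wpt PS j i k.
Proof. by rewrite /wpt [[set j; i]%SET]finset.setUC. Qed.

(** With two triangles k0 and k1 at the edge, the weight equations give the value of [F i j] at
    [wpt PS i j k0] the factor (1 - om k0) B(k0) + om k1 B(k1), which is [Bhalf i j k0], and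
    likewise for k1. On the boundary the share of the edge point is left over. *)
Lemma edge_regroup i j :
  \sum_(k | [set i; j; k]%SET \in tris D)
     F i j (tsplit PS [set i; j; k]%SET) * B (Ft i j k) x =
  \sum_(k | [set i; j; k]%SET \in tris D) F i j (wpt PS i j k) * Bhalf i j k
  + (if [set i; j]%SET \in bedges D then
       F i j (esplit PS [set i; j]%SET) * (om [set i; j]%SET (opposite i j)
         * B (Ft i j (opposite i j)) x)
     else 0).
Proof.
have [_ W_int W_bd] := om_weights.
case: ifPn => [ijB|ijB].
  under eq_bigl do rewrite bedge_apex //.
  under [in RHS]eq_bigl do rewrite bedge_apex //.
  have T : [set i; j; opposite i j]%SET \in tris D by rewrite bedge_apex.
  rewrite !big_pred1_eq /Bhalf big1 => [|k /andP[/negbTE kk]]; last first.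
    by rewrite bedge_apex // kk.
  by rewrite (W_bd _ _ _ ijB T) F_affine; ring.
rewrite addr0.
(* The pair i, j need not be an edge; then both sums are empty. *)
case: (boolP [exists k, [set i; j; k]%SET \in tris D]) => [/existsP[k T]|/existsPn noT];
    last by rewrite !big_pred0 // => k; apply/negbTE/noT.
have ijI : [set i; j]%SET \in edges D :\: bedges D.
  by rewrite inE ijB (tri_edge T).
have [k0 [k1 [k01 TE]]] := iedge_apex ijI.
have sumE (H : vidx D -> R) :
    \sum_(k | [set i; j; k]%SET \in tris D) H k = H k0 + H k1.
  rewrite (bigD1 k0) /= ?TE ?eqxx //; congr (_ + _).
  rewrite (big_pred1 k1) // => l; rewrite /= TE.
  by have [->|] //= := eqVneq l k0; rewrite ?andbF ?(negbTE k01) ?andbT.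
have sum0 (H : vidx D -> R) :
    \sum_(k | (k != k0) && ([set i; j; k]%SET \in tris D)) H k = H k1.
  rewrite (big_pred1 k1) // => l; rewrite /= TE.
  by have [->|] //= := eqVneq l k0; rewrite ?andbF ?(negbTE k01) ?andbT.
have sum1 (H : vidx D -> R) :
    \sum_(k | (k != k1) && ([set i; j; k]%SET \in tris D)) H k = H k0.
  rewrite (big_pred1 k0) // => l; rewrite /= TE.
  have [->|] //= := eqVneq l k1; rewrite ?orbF //.
  by rewrite eq_sym (negbTE k01).
have T0 : [set i; j; k0]%SET \in tris D by rewrite TE eqxx.
have T1 : [set i; j; k1]%SET \in tris D by rewrite TE eqxx orbT.
have k10 : k1 != k0 by rewrite eq_sym.
rewrite !sumE /Bhalf sum0 sum1 (W_int _ _ _ _ ijI T0 T1 k01).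
by rewrite (W_int _ _ _ _ ijI T1 T0 k10) !F_affine; ring.
Qed.

Lemma opposite_sym i j : [set i; j]%SET \in bedges D -> opposite i j = opposite j i.
Proof.
move=> ijB; have T : [set i; j; opposite i j]%SET \in tris D by rewrite bedge_apex.
by apply/eqP; rewrite -bedge_apex [[set j; i]%SET]finset.setUC.
Qed.

Lemma sum_bedges_swap (G : vidx D -> vidx D -> R) :
  \sum_i \sum_(j | [set i; j]%SET \in bedges D) G i j =
  \sum_i \sum_(j | [set i; j]%SET \in bedges D) G j i.
Proof.
have mk (G' : vidx D -> vidx D -> R) :
    \sum_i \sum_(j | [set i; j]%SET \in bedges D) G' i j =
    \sum_i \sum_j if [set i; j]%SET \in bedges D then G' i j else 0.
  by apply: eq_bigr => i _; rewrite big_mkcond.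
rewrite !mk exchange_big; apply: eq_bigr => i _; apply: eq_bigr => j _.
by rewrite finset.setUC.
Qed.

(* Each edge is counted as (i, j) and as (j, i), hence the factor 1/2. *)
Lemma sum_regroup :
  sum_tri (tris D) (fun i j k =>
    F i j (tsplit PS [set i; j; k]%SET) * B (Ft i j k) x)
  + \sum_i \sum_(j | [set i; j]%SET \in bedges D)
      F i j (esplit PS [set i; j]%SET) * B (Fe i j) x =
  sum_tri (tris D) (fun i j k => F i j (wpt PS i j k) / 2 * Be_tri B om i j k x)
  + \sum_i \sum_(j | [set i; j]%SET \in bedges D)
      F i j (esplit PS [set i; j]%SET) / 2 * Be_bd B om i j x.
Proof.
have -> : sum_tri (tris D) (fun i j k => F i j (wpt PS i j k) / 2 * Be_tri B om i j k x)
    = sum_tri (tris D) (fun i j k => F i j (wpt PS i j k) * Bhalf i j k).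
  (* The two halves of [Be_tri] are exchanged by swapping i and j while the coefficient is
     symmetric, so they have equal sums. *)
  transitivity (sum_tri (tris D) (fun i j k =>
      F i j (wpt PS i j k) / 2 * Bhalf i j k + F j i (wpt PS j i k) / 2 * Bhalf j i k)).
    by apply: eq_sum_tri => i j k _; rewrite Be_tri_halves F_sym (wpt_sym j i); ring.
  rewrite sum_triD [X in _ + X]sum_tri_swap -sum_triD.
  by apply: eq_sum_tri => i j k _; field.
(* The terms of [Be_bd] with first index i; the second of them absorbs what [edge_regroup] leaves
   over. *)
pose bd i j := B (Fe i j) x
  + om [set i; j]%SET (opposite i j) * B (Ft i j (opposite i j)) x.
have -> : \sum_i \sum_(j | [set i; j]%SET \in bedges D)
      F i j (esplit PS [set i; j]%SET) / 2 * Be_bd B om i j x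
    = \sum_i \sum_(j | [set i; j]%SET \in bedges D)
        F i j (esplit PS [set i; j]%SET) * bd i j.
  pose G i j := F i j (esplit PS [set i; j]%SET) / 2 * bd i j.
  transitivity (\sum_i \sum_(j | [set i; j]%SET \in bedges D) G i j
                + \sum_i \sum_(j | [set i; j]%SET \in bedges D) G j i).
    rewrite -big_split; apply: eq_bigr => i _; rewrite -big_split.
    apply: eq_bigr => j ijB /=.
    rewrite /G /bd /Be_bd (F_sym j) [[set j; i]%SET]finset.setUC.
    by rewrite -(opposite_sym ijB); ring.
  rewrite -(sum_bedges_swap G) -big_split; apply: eq_bigr => i _; rewrite -big_split.
  by apply: eq_bigr => j _; rewrite /G /=; field.
rewrite /sum_tri.
under eq_bigr do under eq_bigr do rewrite edge_regroup.
rewrite -!big_split; apply: eq_bigr => i _ /=.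
rewrite big_split -addrA; congr (_ + _).
rewrite [X in _ + X = _]big_mkcond [RHS]big_mkcond -big_split.
apply: eq_bigr => j _ /=; case: ifP => _; last by rewrite addr0.
by rewrite -mulrDr addrC.
Qed.

End Regrouping.

(** * Cubics in the reduced space *)

Theorem theorem23 (R : realType) (Omega : set 'rV[R]_2)
    (D : triangulation Omega) (PS : powell_sabin D)
    (q : vidx D -> 'I_3 -> 'rV[R]_2) (q_tri : is_vertex_triangles PS q)
    (nb : vidx D -> vidx D * vidx D)
    (nb_tri : forall i, [set i; (nb i).1; (nb i).2]%SET \in tris D)
    (B : fidx (vidx D) -> 'rV[R]_2 -> R) (B_dual : is_dual_basis PS q nb B)
    (om : {set vidx D} -> vidx D -> R) (om_weights : is_weights PS om) :
  @cubic R `<=` reduced_space PS B om.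
Proof.
move=> P Pc; have [F12 F23 Faff _] := polarization_is_blossom Pc.
pose F (i j : vidx D) := polarization P (vtx i) (vtx j).
have F_affine i j : affine_fun (F i j).
  (* Affinity is known in the first argument and is moved to the third by symmetry. *)
  by move=> s x y; rewrite /F !(F23 _ (vtx j)) !(F12 (vtx i)); exact: Faff.
have F_sym i j w : F i j w = F j i w by exact: F12.
have sym_sub : sym_tris PS \subset tris D.
  by apply/fintype.subsetP => t; rewrite inE => /andP[].
pose cv (p : vidx D * 'I_3) := F p.1 p.1 (vtx p.1 + 3 *: (q p.1 p.2 - vtx p.1)).
(* The sums run over ordered indices: an edge function is met for (i, j) and (j, i), hence the
   factor 1/2, and a symmetric triangle in six orders, hence 1/6. *)
apply: (@eq_span _ _ _ _ (fun x =>
    \sum_p cv p * B (Fv p.1 p.2) x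
    + (\sum_(p : vidx D * vidx D * vidx D |
          [set p.1.1; p.1.2; p.2]%SET \in tris D :\: sym_tris PS)
          F p.1.1 p.1.2 (wpt PS p.1.1 p.1.2 p.2) / 2 * Be_tri B om p.1.1 p.1.2 p.2 x
       + \sum_(p : vidx D * vidx D * vidx D |
          [set p.1.1; p.1.2; p.2]%SET \in sym_tris PS)
          F p.1.1 p.1.2 (vtx p.2) / 6 * Bt_sym B om p.1.1 p.1.2 p.2 x
       + \sum_(p : vidx D * vidx D | [set p.1; p.2]%SET \in bedges D)
          F p.1 p.2 (esplit PS [set p.1; p.2]%SET) / 2
            * Be_bd B om p.1 p.2 x))); last first.
  apply: span_add; first by apply: span_lin => p _; apply: Or41; exists p.1, p.2.
  apply: span_add; last by apply: span_lin => p ?; apply: Or44; exists p.1, p.2.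
  apply: span_add; apply: span_lin => p ?.
    by apply: Or43; exists p.1.1, p.1.2, p.2.
  by apply: Or42; exists p.1.1, p.1.2, p.2.
move=> x xO.
rewrite (dual_expansion nb_tri B_dual (cubic_spline PS Pc) xO).
under eq_bigr do rewrite (beta_cubic _ _ nb_tri Pc) //.
rewrite !big_sumType /=; congr (_ + _).
transitivity (sum_tri (tris D) (fun i j k =>
      F i j (tsplit PS [set i; j; k]%SET) * B (Ft i j k) x)
  + \sum_i \sum_(j | [set i; j]%SET \in bedges D)
      F i j (esplit PS [set i; j]%SET) * B (Fe i j) x).
  by rewrite sum_triE pair_big_dep.
rewrite (sum_regroup om_weights F_affine F_sym) pair_big_dep; congr (_ + _).
rewrite (sum_tri_split _ sym_sub) sum_triE; congr (_ + _).
rewrite -(sum_triE _ (fun i j k => F i j (vtx k) / 6 * Bt_sym B om i j k x)).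
(* In a symmetric triangle [wpt PS i j k] is [vtx k], so each summand is three times [G]; two copies
   are rotated, to bring together the three edges of the triangle. *)
pose G i j k := F i j (vtx k) / 6 * Be_tri B om i j k x.
transitivity (sum_tri (sym_tris PS) (fun i j k => G i j k + G j k i + G k i j)).
  rewrite !sum_triD -(sum_tri_rot _ (fun i j k => G j k i)) -(sum_tri_rot _ G) -!sum_triD.
  by apply: eq_sum_tri => i j k S; rewrite /wpt /= S /G; field.
apply: eq_sum_tri => i j k _; rewrite /G /Bt_sym /F.
(* By symmetry of the blossom the three edges share one coefficient, which factors out of
   [Bt_sym]. *)
have -> : polarization P (vtx j) (vtx k) (vtx i) = polarization P (vtx i) (vtx j) (vtx k).
  by rewrite F23 F12.
have -> : polarization P (vtx k) (vtx i) (vtx j) = polarization P (vtx i) (vtx j) (vtx k).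
  by rewrite F12 F23.
by ring.
Qed.
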